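(* Every PN space $(V,\nu,\tau,\tau^* )$ that, with its strong topology, is a locally convex topological vector space is bornological.
   Context: $\Delta^+$ is the set of distance distribution functions, i.e. nondecreasing functions $F:[-\infty,+\infty]\to[0,1]$, left-continuous on $\mathbb{R}$, with $F(0)=0$ and $F(+\infty)=1$, ordered pointwise. $\varepsilon_a(x)=0$ for $x\le a$ and $1$ for $x>a$. A triangle function is a map $\tau:\Delta^+\times\Delta^+\to\Delta^+$ that is commutative, associative, nondecreasing in each variable, and has $\varepsilon_0$ as identity. A PN space is a quadruple $(V,\nu,\tau,\tau^* )$ with $V$ a real vector space (null vector $\theta$), $\nu:V\to\Delta^+$, $p\mapsto\nu_p$, and $\tau,\tau^*$ triangle functions such that for all $p,q\in V$: (N1) $\nu_p=\varepsilon_0$ iff $p=\theta$; (N2) $\nu_{-p}=\nu_p$; (N3) $\nu_{p+q}\ge\tau(\nu_p,\nu_q)$; (N4) $\nu_p\le\tau^*(\nu_{\lambda p},\nu_{(1-\lambda)p})$ for every $\lambda\in[0,1]$. The strong topology has as neighborhood base at $q$ the sets $N_q(t)=q+N_\theta(t)$, $t>0$, where $N_\theta(t)=\{p:\nu_p(t)>1-t\}$; the hypothesis means that these sets are neighborhood bases of a genuine topology making $V$ a locally convex topological vector space. A locally convex topological vector space $E$ is bornological if every circled (balanced) convex subset $A\subseteq E$ that absorbs every bounded set in $E$ is a neighborhood of $\theta$ (bounded in the usual topological vector space sense). *)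

(* Defs.v *)
From HB Require Import structures.
From mathcomp Require Import all_boot all_order all_algebra.
From mathcomp Require Import all_classical all_reals all_analysis.

Set Implicit Arguments.
Unset Strict Implicit.
Unset Printing Implicit Defensive.

Import Order.TTheory GRing.Theory Num.Theory.
Import numFieldNormedType.Exports.

Local Open Scope classical_set_scope.
Local Open Scope ring_scope.

(* Distance distribution functions; [F -oo = 0] follows from [ddf_0]. *)
Record ddf (R : realType) := Ddf {
  ddf_fun :> \bar R -> R ;
  ddf_itv : forall x, 0 <= ddf_fun x <= 1 ;
  ddf_nondecreasing : forall x y, (x <= y)%E -> ddf_fun x <= ddf_fun y ;
  ddf_left_continuous :
    forall a : R, ddf_fun x%:E @[x --> a^'-] --> ddf_fun a%:E ;
  ddf_0 : ddf_fun 0%E = 0 ;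
  ddf_pinfty : ddf_fun +oo%E = 1 }.

(* Leibniz equality on [ddf] is equality of the underlying functions, and
   [ddf_le] is therefore antisymmetric. *)
Lemma ddf_ext (R : realType) (F G : ddf R) : (forall x, F x = G x) -> F = G.
Proof.
case: F => f f1 f2 f3 f4 f5; case: G => g g1 g2 g3 g4 g5 /= /funext fg.
by subst g; congr Ddf; exact: Prop_irrelevance.
Qed.

Definition ddf_le (R : realType) (F G : ddf R) : Prop :=
  forall x : \bar R, F x <= G x.

Definition eps (R : realType) (a x : \bar R) : R :=
  if (x <= a)%E then 0 else 1.

Section eps0.
Variable R : realType.

Let eps0_itv (x : \bar R) : 0 <= eps 0%E x <= 1.
Proof. by rewrite /eps; case: ifP => _; rewrite ?lexx ?ler01. Qed.

Let eps0_nondecreasing (x y : \bar R) : (x <= y)%E -> eps 0%E x <= eps 0%E y.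
Proof.
rewrite /eps => xy; case: ifPn => [_|x0]; first by case: ifP => _; rewrite ?ler01.
by case: ifPn => // y0; rewrite (le_trans xy y0) in x0.
Qed.

Let eps0_left_continuous (a : R) :
  eps 0%E x%:E @[x --> a^'-] --> eps 0%E a%:E.
Proof.
apply: cvg_near_cst; rewrite /eps !lee_fin.
case: (leP a 0) => a0; near=> x; rewrite lee_fin.
- have xa : x < a by [].
  by rewrite (le_trans (ltW xa) a0).
- have x0 : 0 < x by near: x; exact: nbhs_left_gt.
  by rewrite leNgt x0.
Unshelve. all: by end_near. Qed.

Let eps0_0 : eps 0%E 0%E = 0 :> R.
Proof. by rewrite /eps lexx. Qed.

Let eps0_pinfty : eps 0%E +oo%E = 1 :> R.
Proof. by []. Qed.

Definition eps0 : ddf R :=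
  Ddf eps0_itv eps0_nondecreasing eps0_left_continuous eps0_0 eps0_pinfty.

End eps0.
Arguments eps0 {R}.

Record triangle_function (R : realType) := TriangleFunction {
  triangle_fun :> ddf R -> ddf R -> ddf R ;
  triangleC : commutative triangle_fun ;
  triangleA : associative triangle_fun ;
  triangle_le2r : forall F G H,
    ddf_le F G -> ddf_le (triangle_fun F H) (triangle_fun G H) ;
  triangle_le2l : forall F G H,
    ddf_le F G -> ddf_le (triangle_fun H F) (triangle_fun H G) ;
  triangle_eps0l : left_id eps0 triangle_fun ;
  triangle_eps0r : right_id eps0 triangle_fun }.

Record is_PN_space (R : realType) (V : lmodType R) (nu : V -> ddf R)
    (tau tau_star : triangle_function R) : Prop := IsPNSpace {
  PN_eps0 : forall p, nu p = eps0 <-> p = 0 ;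
  PN_opp : forall p, nu (- p) = nu p ;
  PN_add : forall p q, ddf_le (tau (nu p) (nu q)) (nu (p + q)) ;
  PN_scale : forall (p : V) (l : R), 0 <= l <= 1 ->
    ddf_le (nu p) (tau_star (nu (l *: p)) (nu ((1 - l) *: p))) }.

Definition strong_nbhs0 (R : realType) (V : lmodType R) (nu : V -> ddf R)
    (t : R) : set V :=
  [set p | nu p t%:E > 1 - t].

Definition strong_nbhs (R : realType) (V : lmodType R) (nu : V -> ddf R)
    (q : V) (t : R) : set V :=
  [set q + p | p in strong_nbhs0 nu t].

(* The topology carried by [E] is the strong topology of [nu]: the sets
   [strong_nbhs nu q t], [t > 0], form a base of the neighborhoods of [q]. *)
Definition has_strong_topology (R : realType) (E : tvsType R)
    (nu : E -> ddf R) : Prop :=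
  forall q : E, nbhs q = filter_from [set t : R | 0 < t] (strong_nbhs nu q).

Definition absorbs (R : realType) (V : lmodType R) (A B : set V) : Prop :=
  exists2 r : R, 0 < r & forall a : R, r <= `|a| -> B `<=` [set a *: x | x in A].

Definition circled (R : realType) (V : lmodType R) (A : set V) : Prop :=
  forall a : R, `|a| <= 1 -> [set a *: x | x in A] `<=` A.

(* [bounded_set] of the library is the norm-based notion. *)
Definition tvs_bounded (R : realType) (E : tvsType R) (B : set E) : Prop :=
  forall U : set E, nbhs 0 U -> absorbs U B.

(* [tvsType] is the type of locally convex topological vector spaces. *)
Definition bornological (R : realType) (E : tvsType R) : Prop :=
  forall A : set E, circled A -> convex_set A ->
    (forall B : set E, tvs_bounded B -> absorbs A B) -> nbhs 0 A.

(* Main.v *)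
Require Import Defs.
From mathcomp Require Import all_boot all_order all_algebra.
From mathcomp Require Import all_classical all_reals all_analysis.

(** A locally convex space is bornological as soon as its origin has a
countable base of neighborhoods, and the strong topology has one: the sets
[strong_nbhs0 nu t] shrink with [t], so the values [t = 1 / (n + 1)] suffice.

Let [U_ n] be such a base and let [A] absorb every bounded set. If [A] were
not a neighborhood of [0], neither would any of its dilates be, so that each
[U_ n] would contain a point [u n] outside [(n + 1) A]. The sequence [u]
tends to [0], hence its range is bounded ([cvg0_bounded]) and is absorbed by
[A]; in particular [u n] lies in [(n + 1) A] for [n] large, a contradiction
([countable_base_bornological]). *)

Set Implicit Arguments.
Unset Strict Implicit.
Unset Printing Implicit Defensive.

Import Order.TTheory GRing.Theory Num.Theory.
Import numFieldNormedType.Exports.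

Local Open Scope classical_set_scope.
Local Open Scope ring_scope.

Section bounded_sequences.
Context (R : realType) (E : tvsType R).

Lemma cvg_scale_l (x : E) : (b : R^o) *: x @[b --> (0 : R^o)] --> (0 : E).
Proof.
rewrite -[X in _ --> X](scale0r x).
apply: (@cvg_comp _ _ _ (fun b : R^o => (b, x)) (fun z => z.1 *: z.2) _
  (nbhs ((0 : R^o), x))); last exact: (@scale_continuous R E (0, x)).
by apply: (@cvg_pair _ _ _ _ (nbhs (0 : R^o)) (nbhs x));
  [exact: cvg_id|exact: cvg_cst].
Qed.

Lemma cvg_scale_r (c : R) : c *: x @[x --> (0 : E)] --> (0 : E).
Proof.
rewrite -[X in _ --> X](scaler0 E c).
apply: (@cvg_comp _ _ _ (fun x : E => (c : R^o, x)) (fun z => z.1 *: z.2) _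
  (nbhs ((c : R^o), (0 : E)))); last exact: (@scale_continuous R E (c, 0)).
by apply: (@cvg_pair _ _ _ _ (nbhs (c : R^o)) (nbhs (0 : E)));
  [exact: cvg_cst|exact: cvg_id].
Qed.

(** A dilate of a set that is not a neighborhood of [0] is not one either,
because the inverse homothety is continuous. *)
Lemma nbhs0_scale (c : R) (A : set E) : c != 0 ->
  nbhs 0 [set x | A (c *: x)] -> nbhs 0 A.
Proof.
move=> c0 /(cvg_scale_r c^-1); rewrite /nbhs/=; apply: filterS => x /=.
by rewrite scalerA divff// scale1r.
Qed.

(** Joint continuity of the scaling at [(0, 0)] handles all but finitely many
terms of the sequence at once; each remaining term is shrunk into [U] by
continuity of the scaling in its scalar alone. Taking [b] to be the inverse of
a large scalar turns this into boundedness of the sequence. *)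
Lemma near0_scale_cvg0 (u : nat -> E) (U : set E) :
  u n @[n --> \oo] --> (0 : E) -> nbhs 0 U ->
  \forall b \near (0 : R^o), forall n, U (b *: u n).
Proof.
move=> u0 U0.
have := @scale_continuous R E (0, 0) U; rewrite /= scale0r => /(_ U0).
move=> [[B W] /= [B0 W0] BWU].
have [N _ uW] : \forall n \near \oo, W (u n) by exact: u0.
have small : \forall b \near (0 : R^o), forall n : 'I_N, U (b *: u n).
  apply: (filter_forall (F := nbhs (0 : R^o))) => n.
  exact: cvg_scale_l U0.
apply: filterS2 B0 small => b Bb smallb n.
have [nN|Nn] := ltnP n N; first exact: (smallb (Ordinal nN)).
by apply: (BWU (b, u n)); split => //=; exact: uW.
Qed.

Lemma cvg0_bounded (u : nat -> E) :
  u n @[n --> \oo] --> (0 : E) -> tvs_bounded (range u).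
Proof.
move=> u0 U U0.
have [e /= e0 eU] := near0_scale_cvg0 u0 U0.
(* The scalars of absolute value less than [e] qualify; the factor 2 makes
   the bound on the inverse of [a] strict. *)
exists (2 / e); first by rewrite divr_gt0.
move=> a ea _ [n _ <-].
have a_gt0 : 0 < `|a| by rewrite (lt_le_trans _ ea)// divr_gt0.
exists (a^-1 *: u n); last by rewrite scalerA divff ?scale1r// -normr_gt0.
apply: eU; rewrite /= sub0r normrN normfV invf_plt ?posrE//.
by rewrite (lt_le_trans _ ea)// ltr_pMl ?invr_gt0// ltr1n.
Qed.

(** Failure of [A] to be a neighborhood of [0] yields a sequence tending to
[0] whose [n]-th term escapes the dilate [(n + 1) A]. *)
Lemma countable_base_bornological (U_ : nat -> set E) :
  (forall n, nbhs 0 (U_ n)) ->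
  (forall W : set E, nbhs 0 W -> \forall n \near \oo, U_ n `<=` W) ->
  bornological E.
Proof.
move=> U_0 U_base A _ _ absA; apply: contrapT => nA.
have /choice[u uP] : forall n : nat,
    exists x, U_ n x /\ ~ A (n.+1%:R^-1 *: x).
  move=> n; apply: contrapT => nx; apply: nA.
  apply: (@nbhs0_scale n.+1%:R^-1); first by rewrite invr_eq0 pnatr_eq0.
  apply: filterS (U_0 n) => x Ux; apply: contrapT => nAx.
  by apply: nx; exists x.
have u0 : u n @[n --> \oo] --> (0 : E).
  move=> W /U_base; rewrite /nbhs/=; apply: filterS => n; apply.
  exact: (uP n).1.
have [r r0 rA] := absA _ (cvg0_bounded u0).
have rn : r <= `|(Num.truncn r).+1%:R| by rewrite normr_nat ltW// truncnS_gt.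
have [//|x Ax xu] := rA _ rn (u (Num.truncn r)).
apply: (uP (Num.truncn r)).2.
by rewrite -xu scalerA mulVf ?scale1r// pnatr_eq0.
Qed.

End bounded_sequences.

Section strong_topology.
Context (R : realType).

(** Enlarging [t] both lowers the threshold [1 - t] and raises the value
[nu p t]. *)
Lemma strong_nbhs0_subset (V : lmodType R) (nu : V -> ddf R) (s t : R) :
  s <= t -> strong_nbhs0 nu s `<=` strong_nbhs0 nu t.
Proof.
move=> st p; rewrite /strong_nbhs0/= => sp.
have stp : nu p s%:E <= nu p t%:E by apply: ddf_nondecreasing; rewrite lee_fin.
by rewrite (lt_le_trans _ stp)// (le_lt_trans _ sp)// lerB.
Qed.

Lemma nbhs0_strongE (E : tvsType R) (nu : E -> ddf R) (W : set E) :
  has_strong_topology nu ->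
  nbhs 0 W <-> exists2 t : R, 0 < t & strong_nbhs0 nu t `<=` W.
Proof.
move=> /(_ 0) ->; have idE t : strong_nbhs nu 0 t = strong_nbhs0 nu t.
  by rewrite /strong_nbhs; under eq_imagel do rewrite add0r; rewrite image_id.
by split=> -[t t0]; [rewrite idE|rewrite -idE]; exists t.
Qed.

End strong_topology.

Theorem proposition3p4 (R : realType) (E : tvsType R) (nu : E -> ddf R)
    (tau tau_star : triangle_function R) :
  is_PN_space nu tau tau_star -> has_strong_topology nu -> bornological E.
Proof.
move=> _ nuE.
apply: (@countable_base_bornological _ _
  (fun n => strong_nbhs0 nu n.+1%:R^-1)) => [n|W].
  by apply/(nbhs0_strongE _ nuE); exists n.+1%:R^-1.
move=> /(nbhs0_strongE _ nuE)[t t0 tW].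
have := near_infty_natSinv_lt (PosNum t0); apply: filterS => n /= nt.
by apply: subset_trans tW; apply: strong_nbhs0_subset; exact: ltW.
Qed.
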